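(* Let $A=(a_{ri})$, $B=(b_{sj})$ and $C=(c_{tk})$ be real matrices of sizes $l_1\times n$, $l_2\times m$ and $l_3\times p$, respectively. (1) Let $x=(x_{ij})_{1\le i\le n,\,1\le j\le m}$ be a real two-dimensional array of variables and let $d=(d_{rs})_{1\le r\le l_1,\,1\le s\le l_2}$ be a real array. The array of linear constraints $$\sum_{i=1}^{n}\sum_{j=1}^{m}a_{ri}b_{sj}x_{ij}=d_{rs},\qquad r=1,\ldots,l_1,\quad s=1,\ldots,l_2,$$ ordered in the Fortran style, has the form $$(B\otimes A)\bar{x}=\bar{d},$$ and $$\|(B\otimes A)\bar{x}-\bar{d}\|^2=\bar{x}^T(B^TB\otimes A^TA)\bar{x}-2\big((B^T\otimes A^T)\bar{d}\big)^T\bar{x}+\|\bar{d}\|^2.$$ (2) Let $x=(x_{ijk})_{1\le i\le n,\,1\le j\le m,\,1\le k\le p}$ be a real three-dimensional array of variables and let $d=(d_{rst})_{1\le r\le l_1,\,1\le s\le l_2,\,1\le t\le l_3}$ be a real array. The array of linear constraints $$\sum_{i=1}^{n}\sum_{j=1}^{m}\sum_{k=1}^{p}a_{ri}b_{sj}c_{tk}x_{ijk}=d_{rst},\qquad r=1,\ldots,l_1,\quad s=1,\ldots,l_2,\quad t=1,\ldots,l_3,$$ ordered in the Fortran style, has the form $$(C\otimes B\otimes A)\bar{x}=\bar{d},$$ and $$\|(C\otimes B\otimes A)\bar{x}-\bar{d}\|^2=\bar{x}^T(C^TC\otimes B^TB\otimes A^TA)\bar{x}-2\big((C^T\otimes B^T\otimes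 A^T)\bar d\big)^T\bar{x}+\|\bar{d}\|^2.$$
   Context: For a multidimensional array, the bar denotes the column vector obtained by Fortran-style (column-major) ordering, in which the first index varies fastest. For an array $x=(x_{ij})$ with first index ranging over $1,\dots,n$ and second over $1,\dots,m$, the element $x_{ij}$ is the entry of $\bar x$ in position $n(j-1)+i$; for an array $x=(x_{ijk})$ with index ranges $n,m,p$, the element $x_{ijk}$ is the entry of $\bar x$ in position $nm(k-1)+n(j-1)+i$. The same convention is applied to $d$ (with ranges $l_1,l_2$ or $l_1,l_2,l_3$). ''The array of constraints ordered in the Fortran style has the form $M\bar x=\bar d$'' means that, for each index tuple $(r,s)$ (respectively $(r,s,t)$), the row of $M\bar x=\bar d$ at the position assigned to this tuple by the ordering is exactly the constraint with that index tuple. For an $m\times n$ matrix $A$ and a $p\times q$ matrix $B$, the Kronecker product $A\otimes B$ is the $mp\times nq$ block matrix whose $(i,j)$ block is $a_{ij}B$; that is, the element $a_{ij}b_{kl}$ is in row $p(i-1)+k$ and column $q(j-1)+l$. $\|\cdot\|$ is the Euclidean norm. *)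

(* Defs.v *)
From mathcomp Require Import all_boot all_order all_algebra.
From mathcomp Require Import reals.
From mathcomp.real_closed Require Export mxtens.

Set Implicit Arguments.
Unset Strict Implicit.
Unset Printing Implicit Defensive.

Import GRing.Theory Num.Theory.
Local Open Scope ring_scope.

(* Multidimensional arrays are functions on tuples of ordinals, so all indices
   and positions are 0-based. The Kronecker product of A and B is [tensmx A B]:
   for A : 'M_(m, n) and B : 'M_(p, q), the entry A i j * B k l is in row
   p * i + k and column q * j + l. *)
Notation "A *t B" := (tensmx A B)
  (at level 40, left associativity, format "A  *t  B") : ring_scope.

Lemma tensmx_posE (R : realType) (m n p q : nat)
    (A : 'M[R]_(m, n)) (B : 'M[R]_(p, q))
    (i : 'I_m) (j : 'I_n) (k : 'I_p) (l : 'I_q)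
    (u : 'I_(m * p)) (v : 'I_(n * q)) :
  u = (p * i + k)%N :> nat -> v = (q * j + l)%N :> nat ->
  (A *t B) u v = A i j * B k l.
Proof.
move=> hu hv.
have -> : u = mxtens_index (i, k) by apply: ord_inj; rewrite hu /= mulnC.
have -> : v = mxtens_index (j, l) by apply: ord_inj; rewrite hv /= mulnC.
exact: tensmxE.
Qed.

(* Column-major (Fortran) positions: the first index varies fastest. *)
Definition fpos2 (n m : nat) (i : 'I_n) (j : 'I_m) : 'I_(m * n) :=
  mxtens_index (j, i).

Definition fpos3 (n m p : nat) (i : 'I_n) (j : 'I_m) (k : 'I_p) :
    'I_(p * m * n) :=
  mxtens_index (mxtens_index (k, j), i).

Lemma fpos2E (n m : nat) (i : 'I_n) (j : 'I_m) :
  fpos2 i j = (n * j + i)%N :> nat.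
Proof. by rewrite /= mulnC. Qed.

Lemma fpos3E (n m p : nat) (i : 'I_n) (j : 'I_m) (k : 'I_p) :
  fpos3 i j k = (n * m * k + n * j + i)%N :> nat.
Proof. by rewrite /= mulnDl -mulnA mulnC (mulnC m) (mulnC j). Qed.

Definition fvec2 (R : realType) (n m : nat) (x : 'I_n -> 'I_m -> R) :
    'cV[R]_(m * n) :=
  \col_q x (mxtens_unindex q).2 (mxtens_unindex q).1.

Definition fvec3 (R : realType) (n m p : nat)
    (x : 'I_n -> 'I_m -> 'I_p -> R) : 'cV[R]_(p * m * n) :=
  \col_q x (mxtens_unindex q).2
           (mxtens_unindex (mxtens_unindex q).1).2
           (mxtens_unindex (mxtens_unindex q).1).1.

Lemma fvec2E (R : realType) (n m : nat) (x : 'I_n -> 'I_m -> R)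
    (i : 'I_n) (j : 'I_m) :
  fvec2 x (fpos2 i j) 0 = x i j.
Proof. by rewrite mxE mxtens_indexK. Qed.

Lemma fvec3E (R : realType) (n m p : nat) (x : 'I_n -> 'I_m -> 'I_p -> R)
    (i : 'I_n) (j : 'I_m) (k : 'I_p) :
  fvec3 x (fpos3 i j k) 0 = x i j k.
Proof. by rewrite mxE /fpos3 !mxtens_indexK. Qed.

(* The library's norm on matrices is the sup norm, hence this definition. *)
Definition enorm (R : realType) (n : nat) (v : 'cV[R]_n) : R :=
  Num.sqrt (\sum_(i < n) v i 0 ^+ 2).

(* Main.v *)
Require Import Defs.
From mathcomp Require Import all_boot all_order all_algebra.
From mathcomp Require Import reals.
From mathcomp Require Import ring.

Import GRing.Theory Num.Theory.
Local Open Scope ring_scope.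

(** The column-major position is a bijection between index tuples and
    positions, and the entry of a Kronecker product at the positions of two
    index tuples is the product of the entries of the factors.  Hence a row of
    the matrix-vector product, reindexed by tuples ([sum_fpos2], [sum_fpos3]),
    is the constraint with the corresponding index tuple, and surjectivity of
    the positions ([eq_fvec2P], [eq_fvec3P]) turns equality of all entries into
    equality of vectors.

    The norm identity is the expansion of the squared norm of [M v - d] for an
    arbitrary real matrix [M] ([enorm_mulmxB_sqr]); for a Kronecker product,
    transposition acts factorwise and the mixed-product rule
    (P *t Q) (P' *t Q') = P P' *t Q Q' computes [M^T M]. *)

Section FortranOrder.

Context (R : realType).

Lemma sum_mxtens_index (m n : nat) (F : 'I_(m * n) -> R) :
  \sum_q F q = \sum_(j < m) \sum_(i < n) F (mxtens_index (j, i)).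
Proof.
rewrite pair_big /= (reindex (@mxtens_index m n)) /=.
  by apply: eq_bigr => -[j i].
by exists (@mxtens_unindex m n) => q _; rewrite (mxtens_indexK, mxtens_unindexK).
Qed.

Lemma sum_fpos2 (n m : nat) (F : 'I_(m * n) -> R) :
  \sum_q F q = \sum_(i < n) \sum_(j < m) F (fpos2 i j).
Proof. by rewrite sum_mxtens_index exchange_big. Qed.

Lemma sum_fpos3 (n m p : nat) (F : 'I_(p * m * n) -> R) :
  \sum_q F q = \sum_(i < n) \sum_(j < m) \sum_(k < p) F (fpos3 i j k).
Proof.
by rewrite sum_fpos2; apply: eq_bigr => i _; rewrite sum_fpos2.
Qed.

Lemma eq_fvec2P (n m : nat) (v : 'cV[R]_(m * n)) (d : 'I_n -> 'I_m -> R) :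
  (forall i j, v (fpos2 i j) 0 = d i j) <-> v = fvec2 d.
Proof.
split=> [vd | -> i j]; last exact: fvec2E.
apply/colP => q; rewrite -(mxtens_unindexK q).
by case: (mxtens_unindex q) => j i; rewrite [LHS]vd [RHS]fvec2E.
Qed.

Lemma eq_fvec3P (n m p : nat) (v : 'cV[R]_(p * m * n))
    (d : 'I_n -> 'I_m -> 'I_p -> R) :
  (forall i j k, v (fpos3 i j k) 0 = d i j k) <-> v = fvec3 d.
Proof.
split=> [vd | -> i j k]; last exact: fvec3E.
apply/colP => q; rewrite -(mxtens_unindexK q).
case: (mxtens_unindex q) => kj i; rewrite -(mxtens_unindexK kj).
by case: (mxtens_unindex kj) => k j; rewrite [LHS]vd [RHS]fvec3E.
Qed.

Lemma tensmx_fvec2E (l1 l2 n m : nat) (A : 'M[R]_(l1, n)) (B : 'M[R]_(l2, m))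
    (x : 'I_n -> 'I_m -> R) (r : 'I_l1) (s : 'I_l2) :
  ((B *t A) *m fvec2 x) (fpos2 r s) 0
    = \sum_(i < n) \sum_(j < m) A r i * B s j * x i j.
Proof.
rewrite mxE sum_fpos2; apply: eq_bigr => i _; apply: eq_bigr => j _.
by rewrite fvec2E tensmxE [B s j * _]mulrC.
Qed.

Lemma tensmx_fvec3E (l1 l2 l3 n m p : nat) (A : 'M[R]_(l1, n))
    (B : 'M[R]_(l2, m)) (C : 'M[R]_(l3, p)) (x : 'I_n -> 'I_m -> 'I_p -> R)
    (r : 'I_l1) (s : 'I_l2) (t : 'I_l3) :
  ((C *t B *t A) *m fvec3 x) (fpos3 r s t) 0
    = \sum_(i < n) \sum_(j < m) \sum_(k < p) A r i * B s j * C t k * x i j k.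
Proof.
rewrite mxE sum_fpos3; apply: eq_bigr => i _; apply: eq_bigr => j _.
apply: eq_bigr => k _.
by rewrite fvec3E !tensmxE; ring.
Qed.

End FortranOrder.

Lemma enorm_sqr (R : realType) (n : nat) (v : 'cV[R]_n) :
  enorm v ^+ 2 = (v^T *m v) 0 0.
Proof.
rewrite sqr_sqrtr; last by apply: sumr_ge0 => i _; apply: sqr_ge0.
by rewrite mxE; apply: eq_bigr => i _; rewrite mxE expr2.
Qed.

(** The two cross terms of the expansion are 1 x 1 matrices transposed to each
    other, hence equal; this gives the factor 2. *)
Lemma enorm_mulmxB_sqr (R : realType) (l n : nat) (M : 'M[R]_(l, n))
    (v : 'cV[R]_n) (d : 'cV[R]_l) :
  enorm (M *m v - d) ^+ 2
    = (v^T *m (M^T *m M) *m v) 0 0 - 2%:R * ((M^T *m d)^T *m v) 0 0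
      + enorm d ^+ 2.
Proof.
have cross : ((M *m v)^T *m d) 0 0 = (d^T *m (M *m v)) 0 0.
  by rewrite -{2}(trmxK (M *m v)) -trmx_mul [RHS]mxE.
rewrite !enorm_sqr [(_ - _)^T]linearB /= mulmxBl !mulmxBr.
have entryB (X Y : 'M[R]_1) : (X - Y) 0 0 = X 0 0 - Y 0 0 by rewrite !mxE.
rewrite !entryB cross !trmx_mul trmxK !mulmxA; ring.
Qed.

Theorem mainTheorem2 (R : realType) (l1 l2 l3 n m p : nat)
    (A : 'M[R]_(l1, n)) (B : 'M[R]_(l2, m)) (C : 'M[R]_(l3, p)) :
  (forall (x : 'I_n -> 'I_m -> R) (d : 'I_l1 -> 'I_l2 -> R),
    [/\ forall (r : 'I_l1) (s : 'I_l2),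
          ((B *t A) *m fvec2 x) (fpos2 r s) 0
            = \sum_(i < n) \sum_(j < m) A r i * B s j * x i j
          /\ fvec2 d (fpos2 r s) 0 = d r s,
        (forall (r : 'I_l1) (s : 'I_l2),
           \sum_(i < n) \sum_(j < m) A r i * B s j * x i j = d r s)
        <-> (B *t A) *m fvec2 x = fvec2 d
      & enorm ((B *t A) *m fvec2 x - fvec2 d) ^+ 2
          = ((fvec2 x)^T *m ((B^T *m B) *t (A^T *m A)) *m fvec2 x) 0 0
            - 2%:R * (((B^T *t A^T) *m fvec2 d)^T *m fvec2 x) 0 0
            + enorm (fvec2 d) ^+ 2])
  /\
  (forall (x : 'I_n -> 'I_m -> 'I_p -> R) (d : 'I_l1 -> 'I_l2 -> 'I_l3 -> R),
    [/\ forall (r : 'I_l1) (s : 'I_l2) (t : 'I_l3),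
          ((C *t B *t A) *m fvec3 x) (fpos3 r s t) 0
            = \sum_(i < n) \sum_(j < m) \sum_(k < p)
                A r i * B s j * C t k * x i j k
          /\ fvec3 d (fpos3 r s t) 0 = d r s t,
        (forall (r : 'I_l1) (s : 'I_l2) (t : 'I_l3),
           \sum_(i < n) \sum_(j < m) \sum_(k < p)
             A r i * B s j * C t k * x i j k = d r s t)
        <-> (C *t B *t A) *m fvec3 x = fvec3 d
      & enorm ((C *t B *t A) *m fvec3 x - fvec3 d) ^+ 2
          = ((fvec3 x)^T *m ((C^T *m C) *t (B^T *m B) *t (A^T *m A))
               *m fvec3 x) 0 0
            - 2%:R * (((C^T *t B^T *t A^T) *m fvec3 d)^T *m fvec3 x) 0 0
            + enorm (fvec3 d) ^+ 2]).
Proof.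
split=> x d; split.
- by move=> r s; rewrite tensmx_fvec2E fvec2E.
- rewrite -eq_fvec2P.
  by split=> h r s; have := h r s; rewrite tensmx_fvec2E.
- by rewrite enorm_mulmxB_sqr !trmx_tens !tensmx_mul.
- by move=> r s t; rewrite tensmx_fvec3E fvec3E.
- rewrite -eq_fvec3P.
  by split=> h r s t; have := h r s t; rewrite tensmx_fvec3E.
- by rewrite enorm_mulmxB_sqr !trmx_tens !tensmx_mul.
Qed.
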